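(* Let $p$ be a prime and $k$ a field of characteristic $p$. Let $r$ be a positive integer, $n$ a non-negative integer, and let $\lambda$ be a partition of $r$ such that $\lambda_2<p^n$. Then $$[M^{\lambda+(ap^n)}:Y^{\mu+(ap^n)}]=[M^\lambda:Y^\mu]$$ for every positive integer $a$ and every partition $\mu$ of $r$.
   Context: $\mathcal{S}_r$ is the symmetric group on $r$ letters and all modules are (finite-dimensional, right) modules over the field $k$ of characteristic $p$. For a partition $\lambda$ of $r$, $M^\lambda$ is the Young permutation module: the permutation $k\mathcal{S}_r$-module with basis the set of all $\lambda$-tabloids, equivalently the permutation module on the cosets of the Young subgroup $\mathcal{S}_\lambda=\mathcal{S}_{\lambda_1}\times\mathcal{S}_{\lambda_2}\times\cdots$. The Specht module $S^\lambda$ is the submodule of $M^\lambda$ generated by a polytabloid. In any decomposition of $M^\lambda$ into indecomposable summands there is exactly one summand containing $S^\lambda$ as a submodule; it is well defined up to isomorphism and is called the Young module $Y^\lambda$. Every indecomposable direct summand of $M^\lambda$ is isomorphic to some $Y^\mu$ with $\mu$ a partition of $r$, and $Y^\lambda\cong Y^\mu$ only if $\lambda=\mu$. The $p$-Kostka number $[M^\lambda:Y^\mu]$ is the multiplicity of $Y^\mu$ as a summand in a decomposition of $M^\lambda$ into indecomposable direct summands. Partitions are allowed zero parts at the end, so $\lambda_2=0$ if $\lambda=(r)$. Sums of partitions are taken part by part, so $\lambda+(ap^n)$ is the partition $(\lambda_1+ap^n,\lambda_2,\lambda_3,\dots)$ of $r+ap^n$. *)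

(* Defs.v *)
From mathcomp Require Export all_boot all_order all_algebra all_fingroup.
From mathcomp Require Export mxrepresentation.
From mathcomp Require Export boolp classical_sets.

Set Implicit Arguments.
Unset Strict Implicit.
Unset Printing Implicit Defensive.

Import GroupScope GRing.Theory.

(* Row vectors are acted on from the right, so mx_representation k G n is a
   right kG-module structure on k^n; a submodule is the row space of a square
   matrix U with mxmodule rG U. *)

(* Trailing zero parts are allowed, so a partition may have several
   representatives; the modules below do not depend on it up to isomorphism.
   The part lambda_i is nth 0 lam i.-1. *)
Record intpart (r : nat) := IntPart {
  parts :> seq nat;
  parts_sorted : sorted geq parts;
  parts_sumn : sumn parts = r }.

Definition add_parts (s t : seq nat) : seq nat :=
  mkseq (fun i => nth 0 s i + nth 0 t i)%N (maxn (size s) (size t)).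

Lemma nth_add_parts (s t : seq nat) i :
  nth 0 (add_parts s t) i = (nth 0 s i + nth 0 t i)%N.
Proof.
have [lt_i | ] := ltnP i (maxn (size s) (size t)); first by rewrite nth_mkseq.
move=> le_i; rewrite nth_default ?size_mkseq //.
by move: le_i; rewrite geq_max => /andP[le_s le_t]; rewrite !nth_default.
Qed.

Lemma sumn_widen (s : seq nat) n :
  size s <= n -> sumn s = (\sum_(i < n) nth 0 s i)%N.
Proof.
move=> le_n; rewrite sumnE (big_nth 0) big_mkord.
rewrite (big_ord_widen_cond n xpredT (fun i => nth 0 s i)) // big_mkcond /=.
apply: eq_bigr => i _; case: ltnP => // le_i; by rewrite nth_default.
Qed.

Lemma add_parts_sorted (s t : seq nat) :
  sorted geq s -> sorted geq t -> sorted geq (add_parts s t).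
Proof.
have desc (u : seq nat) : sorted geq u -> forall i, nth 0 u i.+1 <= nth 0 u i.
  move=> /(sortedP 0) su i; have [/su // | le_i] := ltnP i.+1 (size u).
  by rewrite nth_default.
move=> /desc ss /desc st; apply/(sortedP 0) => i _.
by rewrite !nth_add_parts; apply: leq_add.
Qed.

Lemma sumn_add_parts (s t : seq nat) :
  sumn (add_parts s t) = (sumn s + sumn t)%N.
Proof.
rewrite (@sumn_widen _ (maxn (size s) (size t))) ?size_mkseq //.
rewrite (sumn_widen (leq_maxl (size s) (size t))).
rewrite (sumn_widen (leq_maxr (size s) (size t))) -big_split /=.
by apply: eq_bigr => i _; rewrite nth_add_parts.
Qed.

Definition add_intpart (r s : nat) (lam : intpart r) (nu : intpart s) :
    intpart (r + s) :=
  IntPart (add_parts_sorted (parts_sorted lam) (parts_sorted nu))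
    (etrans (sumn_add_parts lam nu)
            (congr2 addn (parts_sumn lam) (parts_sumn nu))).

Definition one_part (m : nat) : intpart m :=
  @IntPart m [:: m] isT (addn0 m).

Section Modules.

Variables (k : fieldType) (gT : finGroupType) (G : {group gT}).

Definition indecomposable (n : nat) (rG : mx_representation k G n)
    (U : 'M[k]_n) : Prop :=
  [/\ mxmodule rG U, U != 0%R
    & forall V W : 'M[k]_n, mxmodule rG V -> mxmodule rG W ->
        mxdirect (V + W)%MS -> (V + W :=: U)%MS ->
        V = 0%R \/ W = 0%R].

Definition indec_decomposition (n : nat) (rG : mx_representation k G n)
    (m : nat) (Us : 'I_m -> 'M[k]_n) : Prop :=
  [/\ forall i, indecomposable rG (Us i), mxdirect (\sum_i Us i)%MS
    & (\sum_i Us i :=: 1%:M%R)%MS].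

Definition submod_iso (n1 n2 : nat) (rG1 : mx_representation k G n1)
    (U : 'M[k]_n1) (rG2 : mx_representation k G n2) (V : 'M[k]_n2) : Prop :=
  exists (modU : mxmodule rG1 U) (modV : mxmodule rG2 V),
    mx_rsim (submod_repr modU) (submod_repr modV).

(* Decompositions exist by finite dimension and the number of summands
   isomorphic to V is independent of the decomposition (Krull-Schmidt), so
   the set below is a singleton and the default value of xget is not used. *)
Definition multiplicity (n1 n2 : nat) (rG1 : mx_representation k G n1)
    (rG2 : mx_representation k G n2) (V : 'M[k]_n2) : nat :=
  xget 0 [set c : nat | exists (m : nat) (Us : 'I_m -> 'M[k]_n1),
    indec_decomposition rG1 Us /\
    c = #|[pred i : 'I_m | `[< submod_iso rG1 (Us i) rG2 V >]]|]%classic.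

End Modules.

Section YoungModules.

Variables (r : nat) (lam : intpart r).

Let row_type := 'I_(size lam).

(* A tabloid is given by the function sending each letter to the index of its
   row. *)
Definition is_tabloid (T : {ffun 'I_r -> row_type}) : bool :=
  [forall i, #|[set x | T x == i]| == nth 0 lam i].

Definition tabloid := {T : {ffun 'I_r -> row_type} | is_tabloid T}.

(* Permutations act on the right on letters, x |-> s x, with
   (s1 * s2) x = s2 (s1 x); the letter y lies in row i of T.s when s^-1 y lies
   in row i of T. *)
Lemma tabloid_act_subproof (T : tabloid) (s : {perm 'I_r}) :
  is_tabloid [ffun y => val T (s^-1 y)].
Proof.
apply/forallP=> i; rewrite -(eqP (forallP (valP T) i)).
apply/eqP; rewrite -[RHS](card_imset _ (@perm_inj _ s)); apply: eq_card => y.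
rewrite inE ffunE; apply/idP/imsetP => [Ty | [x + ->]].
  by exists (s^-1 y); rewrite ?permKV // inE.
by rewrite inE permK.
Qed.

Definition tabloid_act (T : tabloid) (s : {perm 'I_r}) : tabloid :=
  Sub [ffun y => val T (s^-1 y)] (tabloid_act_subproof T s).

Definition diagram : {set row_type * 'I_r} :=
  [set u : row_type * 'I_r | u.2 < nth 0 lam u.1].

(* A tableau, i.e. a bijective filling of the diagram by the letters, is given
   by the inverse bijection, sending each letter to its (row, column). *)
Definition is_tableau (t : {ffun 'I_r -> row_type * 'I_r}) : bool :=
  injectiveb t && (t @: [set: 'I_r] == diagram).

Definition tableau := {t : {ffun 'I_r -> row_type * 'I_r} | is_tableau t}.

Lemma tabloid_of_subproof (t : tableau) : is_tabloid [ffun x => (val t x).1].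
Proof.
case: t => t /= /andP[/injectiveP inj_t /eqP im_t]; apply/forallP=> i.
have le_i : nth 0 lam i <= r.
  rewrite -[leqRHS](parts_sumn lam) sumnE (big_nth 0) big_mkord (bigD1 i) //=.
  exact: leq_addr.
apply/eqP; rewrite -(card_imset _ inj_t).
have inj_w : injective (fun j : 'I_(nth 0 lam i) => (i, widen_ord le_i j)).
  by move=> j1 j2 [] /ord_inj.
rewrite -[RHS]card_ord -(card_imset _ inj_w); apply: eq_card => u.
apply/imsetP/imsetP => [[x + ->] | [j _ ->]].
  rewrite inE ffunE => /eqP def_i.
  have: t x \in diagram by rewrite -im_t imset_f ?inE.
  rewrite inE def_i => lt_x; exists (Ordinal lt_x) => //.
  by rewrite [LHS]surjective_pairing def_i; congr (_, _); apply: val_inj.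
have /imsetP[x _ def_x] : (i, widen_ord le_i j) \in t @: [set: 'I_r].
  by rewrite im_t inE /=.
by exists x; rewrite // inE ffunE -def_x.
Qed.

Definition tabloid_of (t : tableau) : tabloid :=
  Sub [ffun x => (val t x).1] (tabloid_of_subproof t).

Definition column_stabiliser (t : tableau) : {set {perm 'I_r}} :=
  [set s : {perm 'I_r} | [forall x, (val t (s x)).2 == (val t x).2]].

Variable k : fieldType.

Definition young_perm_mx (s : {perm 'I_r}) : 'M[k]_(#|{: tabloid}|) :=
  (\matrix_(i, j) (tabloid_act (enum_val i) s == enum_val j)%:R)%R.

Lemma young_perm_mx_repr : mx_repr [set: {perm 'I_r}] young_perm_mx.
Proof.
have act1 T : tabloid_act T 1 = T.
  by apply/val_inj/ffunP=> y; rewrite /= ffunE invg1 perm1.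
have actM T s1 s2 :
    tabloid_act T (s1 * s2) = tabloid_act (tabloid_act T s1) s2.
  by apply/val_inj/ffunP=> y; rewrite /= !ffunE /= invMg permM.
split=> [|s1 s2 _ _]; apply/matrixP=> i j; rewrite !mxE.
  by rewrite act1 (inj_eq enum_val_inj).
rewrite (bigD1 (enum_rank (tabloid_act (enum_val i) s1))) //= !mxE.
rewrite enum_rankK eqxx GRing.mul1r actM big1 ?GRing.addr0 // => l ne_l.
rewrite !mxE; case: eqP => [eq_l | _]; last by rewrite GRing.mul0r.
by rewrite eq_l enum_valK eqxx in ne_l.
Qed.

Definition young_perm_module :
    mx_representation k [set: {perm 'I_r}] #|{: tabloid}| :=
  MxRepresentation young_perm_mx_repr.

Definition tabloid_vec (T : tabloid) : 'rV[k]_(#|{: tabloid}|) :=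
  delta_mx 0%R (enum_rank T).

Definition polytabloid (t : tableau) : 'rV[k]_(#|{: tabloid}|) :=
  (\sum_(s in column_stabiliser t)
     (-1) ^+ (odd_perm s) *: tabloid_vec (tabloid_act (tabloid_of t) s))%R.

(* This submodule does not depend on the tableau t, since the symmetric group
   permutes the polytabloids transitively. *)
Definition specht (t : tableau) : 'M[k]_(#|{: tabloid}|) :=
  cyclic_mx young_perm_module (polytabloid t).

Definition is_young_module (Y : 'M[k]_(#|{: tabloid}|)) : Prop :=
  exists (m : nat) (Us : 'I_m -> 'M[k]_(#|{: tabloid}|)) (i : 'I_m)
         (t : tableau),
    [/\ indec_decomposition young_perm_module Us,
        Y = Us i & (specht t <= Y)%MS].

(* Such a Y exists by the submodule theorem and is unique up to isomorphism,
   so the default value of xget is not used. *)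
Definition young_module : 'M[k]_(#|{: tabloid}|) :=
  xget 0%R [set Y | is_young_module Y]%classic.

End YoungModules.

Definition p_kostka (k : fieldType) (r : nat) (lam mu : intpart r) : nat :=
  multiplicity (young_perm_module lam k)
               (young_perm_module mu k) (young_module mu k).

(* Main.v *)
From mathcomp Require Import pgroup cyclic sylow.
Require Import Defs.

(** Write m = a p^n. The proof reduces multiplicities of Young modules to a
    pairing of homomorphisms between permutation modules, and compares the
    pairings for r and r + m by the Brauer homomorphism.

    The signed column sum of a tableau t of shape mu maps M^mu onto the line of
    the polytabloid e_t (antisymmetrizer_tabloid). Hence every endomorphism of
    M^mu has e_t as an eigenvector (polytabloid_eigen), and Y^mu is the summand
    that contains e_t. By Fitting's lemma, [M^lambda : Y^mu] is the rank of the
    bilinear pairing that sends f : M^mu -> M^lambda and g : M^lambda -> M^mu to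
    the eigenvalue of f g at e_t (multiplicity_dual_homs): the summands of
    M^lambda isomorphic to Y^mu contribute forms of rank one, and the others
    contribute nothing. The rank is expressed as the largest size of a pair of
    dual families, which requires no choice of bases.

    Let c be a permutation of the last m letters, all of whose cycles have
    length p^n. A tabloid of shape lambda + (m) that is fixed by c has each
    cycle in a single row. As lambda_2 < p^n, this is the first row, so the
    fixed tabloids are the tabloids of shape lambda, extended by the last m
    letters in the first row (rotation_fixed). Restriction of matrices to the
    fixed tabloids maps homomorphisms M^(mu + (m)) -> M^(lambda + (m)) to
    homomorphisms M^mu -> M^lambda, and likewise in the other direction. It is
    onto, since the relative position of two tabloids is given by a matrix of
    cardinalities and extension adds m to one entry of it (restrict_hom_onto).
    It preserves the pairing (pairing_restrict): if the last m letters are put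
    at the end of the first row of t, they are alone in their columns, so the
    column stabiliser does not change, and a sum over tabloids of a function
    that is invariant under c is the sum over the fixed ones, in characteristic
    p (sum_fixed_points). Hence the two pairings have the same rank. *)

Set Implicit Arguments.
Unset Strict Implicit.
Unset Printing Implicit Defensive.

Import GRing.Theory.

(** * Homomorphisms and indecomposable modules *)

Section Homomorphisms.

Variables (k : fieldType) (gT : finGroupType) (G : {group gT}).

Local Open Scope ring_scope.

Definition mx_hom n1 n2 (rG1 : mx_representation k G n1)
    (rG2 : mx_representation k G n2) (f : 'M[k]_(n1, n2)) : Prop :=
  forall x, x \in G -> rG1 x *m f = f *m rG2 x.

Lemma mx_homM n1 n2 n3 (rG1 : mx_representation k G n1)
    (rG2 : mx_representation k G n2) (rG3 : mx_representation k G n3) f g :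
  mx_hom rG1 rG2 f -> mx_hom rG2 rG3 g -> mx_hom rG1 rG3 (f *m g).
Proof. by move=> hf hg x Gx; rewrite mulmxA hf // -!mulmxA hg. Qed.

Lemma mx_hom1 n (rG : mx_representation k G n) : mx_hom rG rG 1%:M.
Proof. by move=> x _; rewrite mulmx1 mul1mx. Qed.

Lemma mx_hom_module n1 n2 (rG1 : mx_representation k G n1)
    (rG2 : mx_representation k G n2) f m (U : 'M_(m, n1)) :
  mx_hom rG1 rG2 f -> mxmodule rG1 U -> mxmodule rG2 (U *m f).
Proof.
move=> hf /mxmoduleP modU; apply/mxmoduleP=> x Gx.
by rewrite -mulmxA -hf // mulmxA submxMr ?modU.
Qed.

Lemma mx_hom_kermx_module n1 n2 (rG1 : mx_representation k G n1)
    (rG2 : mx_representation k G n2) f m (U : 'M_(m, n1)) :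
  mx_hom rG1 rG2 f -> mxmodule rG1 U -> mxmodule rG1 (U :&: kermx f)%MS.
Proof.
move=> hf /mxmoduleP modU; apply/mxmoduleP=> x Gx.
rewrite sub_capmx (submx_trans _ (modU x Gx)) ?submxMr ?capmxSl //=.
apply/sub_kermxP; rewrite -mulmxA hf // mulmxA.
by rewrite (sub_kermxP (capmxSr _ _)) mul0mx.
Qed.

(** A submodule that a homomorphism does not shrink, and whose image is the
    whole image of U, is complemented in U by the kernel. *)
Lemma indecomposable_retract n1 n2 (rG1 : mx_representation k G n1)
    (rG2 : mx_representation k G n2) f (U : 'M_n1) m (W : 'M_(m, n1)) :
    indecomposable rG1 U -> mx_hom rG1 rG2 f -> mxmodule rG1 W ->
    (W <= U)%MS -> W != 0 -> (U *m f <= W *m f)%MS ->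
    (\rank W <= \rank (W *m f))%N ->
  (U <= W)%MS.
Proof.
move=> [modU _ indU] hf modW sWU nzW sUfWf rW.
pose K := (U :&: kermx f)%MS.
have modK : mxmodule rG1 K := mx_hom_kermx_module hf modU.
have W0 : (W :&: kermx f)%MS = 0.
  apply/eqP; rewrite -mxrank_eq0 -(eqn_add2l (\rank (W *m f))) addn0.
  by rewrite mxrank_mul_ker eqn_leq rW mxrankM_maxl.
have dW : mxdirect (<<W>> + K).
  apply/mxdirect_addsP/eqP; rewrite -submx0 -W0 sub_capmx.
  by rewrite (submx_trans (capmxSl _ _)) ?genmxE // (submx_trans (capmxSr _ _))
    ?capmxSr.
have defU : (<<W>> + K :=: U)%MS.
  apply/eqmxP/andP; split; first by rewrite addsmx_sub genmxE sWU capmxSl.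
  have [D defD] := submxP sUfWf; rewrite -[X in (X <= _)%MS](subrK (D *m W)).
  rewrite addrC addmx_sub_adds ?genmxE ?submxMl // sub_capmx.
  rewrite addmx_sub ?eqmx_opp ?mulmx_sub //=.
  by apply/sub_kermxP; rewrite mulmxBl defD mulmxA subrr.
have modW' : mxmodule rG1 <<W>>%MS by rewrite (eqmx_module _ (genmxE W)).
case: (indU _ _ modW' modK dW defU) => [/eqP | K0].
  by rewrite -mxrank_eq0 mxrank_gen mxrank_eq0 (negPf nzW).
by rewrite -defU K0 addsmx0 genmxE.
Qed.

(** Fitting's lemma, with a nonzero eigenvalue as the reason why x is not
    nilpotent. *)
Lemma indecomposable_endo_onto n (rG : mx_representation k G n) (U : 'M_n) x
    (v : 'rV_n) (c : k) :
    indecomposable rG U -> mx_hom rG rG x -> (U *m x <= U)%MS ->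
    (v <= U)%MS -> v != 0 -> c != 0 -> v *m x = c *: v ->
  (U <= U *m x)%MS.
Proof.
move=> indU hx sUx sv nzv nzc vx.
pose X j := iter j (fun W : 'M_n => W *m x) 1%:M.
have hX j : mx_hom rG rG (X j).
  by elim: j => [|j IHj]; [exact: mx_hom1 | exact: mx_homM IHj hx].
have vX j : v *m X j = c ^+ j *: v.
  elim: j => [|j IHj] /=; first by rewrite mulmx1 scale1r.
  by rewrite mulmxA IHj -scalemxAl vx scalerA -exprSr.
have sUX j : (U *m X j <= U)%MS.
  elim: j => [|j IHj] /=; first by rewrite mulmx1.
  by rewrite mulmxA (submx_trans _ sUx) ?submxMr.
(* The ranks of the iterated images of U cannot decrease for ever. *)
have [j rj] : exists j, (\rank (U *m X j) <= \rank (U *m X j *m x))%N.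
  apply: contrapT => no_j.
  have rlt j : (\rank (U *m X j) + j <= \rank U)%N.
    elim: j => [|j IHj]; first by rewrite addn0 mulmx1.
    apply: leq_trans IHj; rewrite addnS -addSn leq_add2r /= mulmxA ltnNge.
    by apply/negP=> rj; apply: no_j; exists j.
  by have := rlt (\rank U).+1; rewrite addnS ltnNge leq_addl.
have sUXx : (U *m X j *m x <= U *m X j)%MS.
  elim: j {rj} => [|j IHj] /=; first by rewrite mulmx1.
  by rewrite mulmxA submxMr.
have sXx : (U *m X j <= U *m X j *m x)%MS.
  by rewrite -(geq_leqif (mxrank_leqif_sup sUXx)).
have sXX i : (U *m X j <= U *m X j *m X i)%MS.
  elim: i => [|i IHi] /=; first by rewrite mulmx1.
  by rewrite [X in (_ <= X)%MS]mulmxA (submx_trans sXx) // submxMr.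
(* x is bijective on the stable image, so the stable image is complemented. *)
have sU : (U <= U *m X j)%MS.
  apply: (indecomposable_retract indU (hX j)) => //.
  - exact: mx_hom_module (hX j) (let: And3 mU _ _ := indU in mU).
  - apply: contraNneq nzv => X0; have := submxMr (X j) sv.
    by rewrite X0 submx0 vX scalemx_eq0 expf_eq0 (negPf nzc) andbF.
  - exact: mxrankS (sXX j).
by rewrite (submx_trans sU) // (submx_trans sXx) ?submxMr.
Qed.

Lemma submod_iso_of_hom n1 n2 (rG1 : mx_representation k G n1)
    (rG2 : mx_representation k G n2) g (U : 'M_n1) (V : 'M_n2) :
    mxmodule rG1 U -> mxmodule rG2 V -> mx_hom rG1 rG2 g ->
    (U *m g :=: V)%MS -> \rank U = \rank V ->
  submod_iso rG1 U rG2 V.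
Proof.
move=> modU modV hg defV eqr; exists modU, modV.
have sV : (val_submod (1%:M : 'M_(\rank U)) *m g <= V)%MS.
  by rewrite -defV submxMr ?val_submodP.
exists (in_submod V (val_submod 1%:M *m g)) => // [|x Gx].
  rewrite /row_free mxrank_in_submod //.
  by rewrite (eqmxMr _ (val_submod1 U)) defV eqr.
rewrite -(in_submodJ modV) // [LHS]mulmxA; congr (in_submod V _).
rewrite -[RHS]mulmxA -hg // [LHS]mulmxA [RHS]mulmxA; congr (_ *m g).
by rewrite -val_submodE -(val_submodJ modU) // mul1mx.
Qed.

(** Fitting's lemma applied to the round trip Y -> V -> Y turns a
    non-nilpotent round trip into an isomorphism. *)
Lemma indecomposable_eigen_iso n1 n2 (rG1 : mx_representation k G n1)
    (rG2 : mx_representation k G n2) f g (V : 'M_n1) (Y : 'M_n2)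
    (v : 'rV_n2) (c : k) :
    indecomposable rG1 V -> indecomposable rG2 Y ->
    mx_hom rG2 rG1 f -> mx_hom rG1 rG2 g ->
    (Y *m f <= V)%MS -> (V *m g <= Y)%MS ->
    (v <= Y)%MS -> v != 0 -> c != 0 -> v *m f *m g = c *: v ->
  submod_iso rG1 V rG2 Y.
Proof.
move=> indV indY hf hg sYf sVg sv nzv nzc vfg.
have sYfg : (Y <= Y *m f *m g)%MS.
  rewrite -mulmxA; apply: (indecomposable_endo_onto indY (mx_homM hf hg) _ sv
    nzv nzc); last by rewrite mulmxA.
  by rewrite mulmxA (submx_trans _ sVg) ?submxMr.
have [modV _ _] := indV; have [modY _ _] := indY.
have rYf : \rank (Y *m f) = \rank Y.
  apply/eqP; rewrite eqn_leq mxrankM_maxl.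
  by rewrite (leq_trans (mxrankS sYfg)) ?mxrankM_maxl.
have sVYf : (V <= Y *m f)%MS.
  apply: (indecomposable_retract indV hg) => //.
  - exact: mx_hom_module hf modY.
  - apply: contraNneq nzv => Yf0; have := submxMr f sv.
    rewrite Yf0 => /submx0null vf0; move/eqP: vfg.
    by rewrite vf0 mul0mx eq_sym scalemx_eq0 (negPf nzc).
  - exact: submx_trans sVg sYfg.
  - by rewrite (leq_trans (mxrankM_maxl _ _)) // mxrankS.
apply: submod_iso_of_hom hg _ _ => //.
  by apply/eqmxP; rewrite sVg (submx_trans sYfg) ?submxMr.
rewrite -rYf; apply/eqP; rewrite eqn_leq !mxrankS //.
Qed.

(** The form in which an isomorphism of direct summands is used: extended by
    zero on the complements, it and its inverse factor each projection through
    the other module. *)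
Lemma submod_iso_factor n1 n2 (rG1 : mx_representation k G n1)
    (rG2 : mx_representation k G n2) (U : 'M_n1) (V : 'M_n2) e1 e2 :
    mx_hom rG1 rG1 e1 -> (e1 <= U)%MS -> U *m e1 = U ->
    mx_hom rG2 rG2 e2 -> (e2 <= V)%MS -> V *m e2 = V ->
    submod_iso rG1 U rG2 V ->
  exists f g, [/\ mx_hom rG2 rG1 f, mx_hom rG1 rG2 g, g *m f = e1,
    f *m g = e2 & f *m e1 = f /\ e1 *m g = g].
Proof.
move=> he1 se1 Ue1 he2 se2 Ve2 [modU [modV [B eqr freeB homB]]].
have [C BK KB] : exists2 C, B *m C = 1%:M & C *m B = 1%:M.
  exists (pinvmx B); first exact: mulmxVp.
  by apply: mulVpmx; rewrite /row_full (eqP freeB) eqr.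
have homB' x : x \in G ->
    submod_repr modV x *m C = C *m submod_repr modU x.
  move=> Gx; rewrite -[submod_repr modV x]mul1mx -KB -(mulmxA _ B) -homB //.
  by rewrite -2!mulmxA BK mulmx1.
pose IU := in_submod U 1%:M; pose JU := val_submod (1%:M : 'M_(\rank U)).
pose IV := in_submod V 1%:M; pose JV := val_submod (1%:M : 'M_(\rank V)).
have JIU : JU *m IU = 1%:M by rewrite -in_submodE val_submodK.
have JIV : JV *m IV = 1%:M by rewrite -in_submodE val_submodK.
have IJU m (w : 'M_(m, n1)) : (w <= U)%MS -> w *m IU *m JU = w.
  by move=> sw; rewrite -in_submodE -val_submodE in_submodK.
have IJV m (w : 'M_(m, n2)) : (w <= V)%MS -> w *m IV *m JV = w.
  by move=> sw; rewrite -in_submodE -val_submodE in_submodK.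
have JUe : JU *m e1 = JU.
  have /submxP[D ->] : (JU <= U)%MS by apply: val_submodP.
  by rewrite -mulmxA Ue1.
have JVe : JV *m e2 = JV.
  have /submxP[D ->] : (JV <= V)%MS by apply: val_submodP.
  by rewrite -mulmxA Ve2.
have homI n (rG : mx_representation k G n) (W : 'M_n)
    (modW : mxmodule rG W) e x :
    mx_hom rG rG e -> (e <= W)%MS -> x \in G ->
    rG x *m (e *m in_submod W 1%:M) =
    e *m in_submod W 1%:M *m submod_repr modW x.
  move=> he se Gx; rewrite mulmxA he // -!in_submodE; exact: in_submodJ.
have homJ n (rG : mx_representation k G n) (W : 'M_n) (modW : mxmodule rG W) x :
    x \in G -> submod_repr modW x *m val_submod (1%:M : 'M_(\rank W)) =
    val_submod (1%:M : 'M_(\rank W)) *m rG x.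
  by move=> Gx; rewrite -val_submodE -(val_submodJ modW) // mul1mx.
have assoc4 q1 q2 q3 q4 (A : 'M_q1) (a : 'M_(q1, q2)) (b : 'M_(q2, q3))
    (c : 'M_(q3, q4)) (D : 'M_q4) (S : 'M[k]_q2) (S' : 'M_q3) :
    A *m a = a *m S -> S *m b = b *m S' -> S' *m c = c *m D ->
    A *m (a *m b *m c) = a *m b *m c *m D.
  move=> h1 h2 h3.
  by rewrite !mulmxA h1 -(mulmxA a) h2 mulmxA -mulmxA h3 mulmxA.
have hf : mx_hom rG2 rG1 (e2 *m IV *m C *m JU).
  by move=> x Gx; apply: assoc4; [apply: homI | apply: homB' | apply: homJ].
have hg : mx_hom rG1 rG2 (e1 *m IU *m B *m JV).
  by move=> x Gx; apply: assoc4; [apply: homI | apply: homB | apply: homJ].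
have {}IJU := IJU _ _ se1; have {}IJV := IJV _ _ se2.
have e11 : e1 *m e1 = e1 by have /submxP[D {1 3}->] := se1; rewrite -mulmxA Ue1.
clearbody IU JU IV JV.
exists (e2 *m IV *m C *m JU), (e1 *m IU *m B *m JV); split=> //.
- rewrite !mulmxA -(mulmxA _ JV e2) JVe -(mulmxA _ JV IV) JIV mulmx1.
  by rewrite -(mulmxA _ B) BK mulmx1 IJU.
- rewrite !mulmxA -(mulmxA _ JU e1) JUe -(mulmxA _ JU IU) JIU mulmx1.
  by rewrite -(mulmxA _ (C)) KB mulmx1 IJV.
- by split; [rewrite -mulmxA JUe | rewrite !mulmxA e11].
Qed.

End Homomorphisms.

(** * Multiplicities as ranks *)

Section Decompositions.

Variables (k : fieldType) (gT : finGroupType) (G : {group gT}).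

Local Open Scope ring_scope.

Lemma mxdirect_sum_ord n m (Us : 'I_m -> 'M[k]_n) :
  mxdirect (\sum_i Us i) = (\rank (\sum_i Us i)%MS == \sum_i \rank (Us i))%N.
Proof. by []. Qed.

Lemma indec_decomposition_exists n (rG : mx_representation k G n) :
  exists (m : nat) (Us : 'I_m -> 'M[k]_n), indec_decomposition rG Us.
Proof.
suff dec (U : 'M_n) : mxmodule rG U -> exists m (Us : 'I_m -> 'M[k]_n),
    [/\ forall i, indecomposable rG (Us i), mxdirect (\sum_i Us i)%MS
      & (\sum_i Us i :=: U)%MS].
  exact: dec (mxmodule1 rG).
have [d] := ubnP (\rank U); elim: d U => // d IHd U ltUd modU.
have [-> | nzU] := eqVneq U 0.
  exists 0%N, (fun=> 0); split=> [[] //| |].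
    by rewrite mxdirect_sum_ord !big_ord0 mxrank0.
  by rewrite big_ord0.
have [indU | ] := pselect (indecomposable rG U).
  exists 1%N, (fun=> U); split=> // [|].
    by rewrite mxdirect_sum_ord !big_ord1.
  by rewrite big_ord1.
move=> not_indU.
have [V [W [modV modW dVW defU [nzV nzW]]]] : exists V W : 'M_n,
  [/\ mxmodule rG V, mxmodule rG W, mxdirect (V + W)%MS, (V + W :=: U)%MS
    & V <> 0 /\ W <> 0].
  apply: contrapT => no_VW; apply: not_indU; split=> // V W modV modW dVW defU.
  apply: contrapT => /not_orP nzVW; apply: no_VW; exists V, W.
  by split.
have rU : \rank U = (\rank V + \rank W)%N by rewrite -defU; apply/eqP.
have rV0 : (0 < \rank V)%N by rewrite lt0n mxrank_eq0; apply/eqP.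
have rW0 : (0 < \rank W)%N by rewrite lt0n mxrank_eq0; apply/eqP.
have [|m1 [U1 [ind1 d1 def1]]] := IHd V _ modV.
  by rewrite -ltnS (leq_trans _ ltUd) // ltnS rU -addn1 leq_add2l.
have [|m2 [U2 [ind2 d2 def2]]] := IHd W _ modW.
  by rewrite -ltnS (leq_trans _ ltUd) // ltnS rU -add1n leq_add2r.
pose Us i := match split i with inl j => U1 j | inr j => U2 j end.
have UsL j : Us (lshift m2 j) = U1 j.
  by rewrite /Us -[lshift _ _]/(unsplit (inl j)) unsplitK.
have UsR j : Us (rshift m1 j) = U2 j.
  by rewrite /Us -[rshift _ _]/(unsplit (inr j)) unsplitK.
have defS : (\sum_i Us i :=: U)%MS.
  rewrite big_split_ord /= (eq_bigr U1) // (eq_bigr U2) //.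
  by apply: eqmx_trans defU; apply: adds_eqmx.
exists (m1 + m2)%N, Us; split=> // [i|].
  by rewrite /Us; case: split.
rewrite mxdirect_sum_ord defS rU big_split_ord /=.
move: d1 d2; rewrite !mxdirect_sum_ord def1 def2 => /eqP-> /eqP->.
by apply/eqP; congr addn; apply: eq_bigr => i _; rewrite ?UsL ?UsR.
Qed.

(** The passage from summands to the endomorphism algebra: a decomposition
    of the module is an orthogonal decomposition of 1 into idempotents. *)
Lemma indec_decomposition_proj n (rG : mx_representation k G n) m
    (Us : 'I_m -> 'M[k]_n) :
    indec_decomposition rG Us ->
  exists e : 'I_m -> 'M[k]_n,
    [/\ forall i,
          [/\ mx_hom rG rG (e i), (e i <= Us i)%MS & Us i *m e i = Us i],
        forall i j, i != j -> e i *m e j = 0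
      & \sum_i e i = 1%:M].
Proof.
move=> [indU dU defU].
pose R i := (\sum_(j | j != i) Us j)%MS.
have UR0 i : (Us i :&: R i = 0)%MS by have /mxdirect_sumsP-> := dU.
have UR1 i : (Us i + R i :=: 1%:M)%MS.
  by apply: eqmx_trans defU; rewrite (bigD1 i) //=.
have modU i : mxmodule rG (Us i) by case: (indU i).
have modR i : mxmodule rG (R i) by apply: sumsmx_module.
have UsE i j : i != j -> Us i *m proj_mx (Us j) (R j) = 0.
  by move=> nij; rewrite proj_mx_0 // (sumsmx_sup i).
have UsK i : Us i *m proj_mx (Us i) (R i) = Us i by rewrite proj_mx_id.
exists (fun i => proj_mx (Us i) (R i)); split=> [i | i j nij |].
- split=> //; last by rewrite -[X in (X <= _)%MS]mul1mx proj_mx_sub.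
  move=> x Gx; have := proj_mx_hom (UR0 i) (modU i) (modR i).
  move/(submx_trans (_ : (1%:M <= _)%MS)); rewrite UR1 submx_refl => /(_ isT).
  by move/hom_mxP => /(_ x Gx); rewrite !mul1mx.
- have /submxP[D ->] : (proj_mx (Us i) (R i) <= Us i)%MS.
    by rewrite -[X in (X <= _)%MS]mul1mx proj_mx_sub.
  by rewrite -mulmxA UsE ?mulmx0.
have /sub_sumsmxP[u def1] : ((1%:M : 'M[k]_n) <= \sum_i Us i)%MS.
  by rewrite defU.
rewrite -[LHS]mul1mx def1 mulmx_suml.
apply: eq_bigr => i _.
rewrite mulmx_sumr (bigD1 i) //= -mulmxA UsK big1 ?addr0 //.
by move=> j nij; rewrite -mulmxA UsE ?mulmx0 // eq_sym.
Qed.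

End Decompositions.

Section Multiplicity.

Variables (k : fieldType) (gT : finGroupType) (G : {group gT}).

Local Open Scope ring_scope.

(** Families of homomorphisms f_i and g_j that are dual to each other for the
    pairing that sends (f, g) to the eigenvalue of f g at v. The rank of this
    pairing is the largest possible d. *)
Definition dual_homs n1 n2 (rG1 : mx_representation k G n1)
    (rG2 : mx_representation k G n2) (v : 'rV[k]_n2) (d : nat) : Prop :=
  exists (f : 'I_d -> 'M[k]_(n2, n1)) (g : 'I_d -> 'M[k]_(n1, n2)),
    [/\ forall i, mx_hom rG2 rG1 (f i), forall i, mx_hom rG1 rG2 (g i)
      & forall i j, v *m f i *m g j = (i == j)%:R *: v].

(** Split f g along a decomposition of the module of rG1: the eigenvalue at v
    is a sum over the summands. A summand that is not isomorphic to the summand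
    Y of v contributes 0, as otherwise f and g would yield an isomorphism by
    Fitting's lemma. A summand that is isomorphic to Y contributes a product of
    a factor that depends on f and a factor that depends on g, hence a form of
    rank one. So the multiplicity of Y is the rank of the pairing. *)
Lemma multiplicity_dual_homs n1 n2 (rG1 : mx_representation k G n1)
    (rG2 : mx_representation k G n2) (v : 'rV[k]_n2) m (Vs : 'I_m -> 'M[k]_n2)
    (i0 : 'I_m) :
    v != 0 ->
    (forall h, mx_hom rG2 rG2 h -> exists c, v *m h = c *: v) ->
    indec_decomposition rG2 Vs -> (v <= Vs i0)%MS ->
  let c := multiplicity rG1 rG2 (Vs i0) in
  dual_homs rG1 rG2 v c /\ forall d, dual_homs rG1 rG2 v d -> (d <= c)%N.
Proof.
move=> nzv eigv decV; set Y := Vs i0 => sv c.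
have [indY [eY [heY seY YeY]]] : indecomposable rG2 Y /\
    exists e, [/\ mx_hom rG2 rG2 e, (e <= Y)%MS & Y *m e = Y].
  have [e [he _ _]] := indec_decomposition_proj decV.
  by have [indV _ _] := decV; split; [exact: indV | exists (e i0)].
have veY : v *m eY = v by have /submxP[D ->] := sv; rewrite -mulmxA YeY.
have [q [Us [decU def_c]]] : exists (q : nat) (Us : 'I_q -> 'M[k]_n1),
    indec_decomposition rG1 Us /\
    c = #|[pred i : 'I_q | `[< submod_iso rG1 (Us i) rG2 Y >]]|.
  apply: (xgetPex 0%N (P := [set c : nat | exists (m : nat)
    (Us : 'I_m -> 'M[k]_n1), indec_decomposition rG1 Us /\
    c = #|[pred i : 'I_m | `[< submod_iso rG1 (Us i) rG2 Y >]]|]%classic)).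
  have [q [Us decU]] := indec_decomposition_exists rG1.
  by exists #|[pred i : 'I_q | `[< submod_iso rG1 (Us i) rG2 Y >]]|, q, Us.
set A := [pred i : 'I_q | _] in def_c.
have [e [he eij e1]] := indec_decomposition_proj decU.
have [indU _ _] := decU.
have /choice[fg fgP] : forall i, exists fg : 'M[k]_(n2, n1) * 'M[k]_(n1, n2),
    i \in A -> [/\ mx_hom rG2 rG1 fg.1, mx_hom rG1 rG2 fg.2,
      fg.2 *m fg.1 = e i, fg.1 *m fg.2 = eY
      & fg.1 *m e i = fg.1 /\ e i *m fg.2 = fg.2].
  move=> i; have [Ai | nAi] := boolP (i \in A); last by exists (0, 0).
  have [hei sei Uei] := he i; have isoU := elimT (asboolP _) Ai.
  have [f [g fgP]] := submod_iso_factor hei sei Uei heY seY YeY isoU.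
  by exists (f, g).
split.
  exists (fun a => (fg (enum_val (cast_ord def_c a))).1),
         (fun a => (fg (enum_val (cast_ord def_c a))).2).
  split=> [a | a | a b]; try by have [] := fgP _ (enum_valP (cast_ord def_c a)).
  have [_ _ _ ii [fe _]] := fgP _ (enum_valP (cast_ord def_c a)).
  have [_ _ _ _ [_ eg]] := fgP _ (enum_valP (cast_ord def_c b)).
  case: (eqVneq a b) eg => [<- _ | nab eg].
    by rewrite scale1r -mulmxA ii veY.
  rewrite scale0r -fe -eg -!mulmxA (mulmxA (e _) (e _)) eij ?mul0mx ?mulmx0 //.
  by rewrite (inj_eq enum_val_inj) (inj_eq (@cast_ord_inj _ _ _)).
move=> d [f [g [hf hg fgv]]]; rewrite def_c.
have [j0 nzj0] : exists j0, v 0 j0 != 0.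
  by apply/existsP; apply: contraNT nzv; rewrite negb_exists => /forallP v0;
    apply/eqP/rowP=> j; rewrite mxE; apply/eqP; rewrite -[_ == _]negbK.
pose coef w := (w : 'rV[k]_n2) 0 j0 / v 0 j0.
have coefE h : mx_hom rG2 rG2 h -> v *m h = coef (v *m h) *: v.
  by case/eigv=> z ->; rewrite /coef mxE mulfK.
have coefZ z : coef (z *: v) = z by rewrite /coef mxE mulfK.
have coef0 a b i : i \notin A -> coef (v *m f a *m e i *m g b) = 0.
  apply: contraNeq => nz; apply: asboolT.
  have [hei sei Uei] := he i.
  apply: (@indecomposable_eigen_iso _ _ _ _ _ _ _ (f a *m e i) (g b *m eY)
    _ _ v _ (indU i) indY _ _ _ _ sv nzv nz).
  - exact: mx_homM (hf a) hei.
  - exact: mx_homM (hg b) heY.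
  - by rewrite mulmxA mulmx_sub.
  - by rewrite mulmxA mulmx_sub.
  - have := coefE _ (mx_homM (mx_homM (hf a) hei) (hg b)).
    by rewrite !mulmxA => E; rewrite [in LHS]E -scalemxAl veY.
(* The identity matrix of size d factors through the set of summands that are
   isomorphic to Y, so that d is at most the size of this set. *)
pose P := \matrix_(a < d, i < #|A|) coef (v *m f a *m (fg (enum_val i)).2).
pose Q := \matrix_(i < #|A|, b < d) coef (v *m (fg (enum_val i)).1 *m g b).
have PQ : P *m Q = 1%:M.
  apply/matrixP=> a b; rewrite !mxE -(coefZ (a == b)%:R) -fgv.
  rewrite -[f a]mulmx1 -e1 mulmx_sumr mulmx_sumr mulmx_suml /coef summxE.
  rewrite mulr_suml (bigID [in A]) /= [X in _ = _ + X]big1 ?addr0; last first.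
    by move=> i nAi; have := coef0 a b i nAi; rewrite /coef mulmxA.
  rewrite [RHS]big_enum_val /=; apply: eq_bigr => i _; rewrite ![in LHS]mxE.
  have [hF hG <- _ _] := fgP _ (enum_valP i).
  have := coefE _ (mx_homM (hf a) hG); have := coefE _ (mx_homM hF (hg b)).
  rewrite !mulmxA => E1 E2.
  by rewrite [in RHS]E2 -!scalemxAl [in RHS]E1 scalerA -/(coef _) coefZ.
by rewrite -[d](@mxrank1 k) -PQ (leq_trans (mxrankM_maxl _ _)) ?rank_leq_col.
Qed.

End Multiplicity.

(** * Tabloids and column permutations *)

Section Tableaux.

Variables (r : nat) (lam : intpart r).
Implicit Types (T : tabloid lam) (t : tableau lam) (s : {perm 'I_r}).

Lemma tabloid_act1 T : tabloid_act T 1%g = T.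
Proof. by apply/val_inj/ffunP=> y; rewrite /= ffunE invg1 perm1. Qed.

Lemma tabloid_actM T s1 s2 :
  tabloid_act T (s1 * s2)%g = tabloid_act (tabloid_act T s1) s2.
Proof. by apply/val_inj/ffunP=> y; rewrite /= !ffunE /= invMg permM. Qed.

Lemma tabloid_act_eqP T U s :
  tabloid_act T s = U <-> forall x, val U (s x) = val T x.
Proof.
split=> [<- x | TU]; first by rewrite /= ffunE permK.
by apply/val_inj/ffunP=> y; rewrite /= ffunE -TU permKV.
Qed.

Lemma tabloid_act_inj s : injective (fun T => tabloid_act T s).
Proof.
by apply: can_inj (fun T => tabloid_act T s^-1%g) _ => T;
  rewrite -tabloid_actM mulgV tabloid_act1.
Qed.

Lemma card_tabloid_row T i : #|[set x | val T x == i]| = nth 0%N lam i.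
Proof. exact: eqP (forallP (valP T) i). Qed.

Lemma tableau_inj t : injective (val t).
Proof. by have /andP[/injectiveP] := valP t. Qed.

Lemma tableau_mem t x : (val t x).2 < nth 0%N lam (val t x).1.
Proof.
have /andP[_ /eqP im_t] := valP t.
have: val t x \in diagram lam by rewrite -im_t imset_f ?inE.
by rewrite inE.
Qed.

Lemma tableau_onto t (i : 'I_(size lam)) (j : 'I_r) :
  (j < nth 0 lam i)%N -> exists x, val t x = (i, j).
Proof.
move=> lt_j; have /andP[_ /eqP im_t] := valP t.
have: (i, j) \in diagram lam by rewrite inE.
by rewrite -im_t => /imsetP[x _ ->]; exists x.
Qed.

Lemma nth_part_le i : (nth 0 lam i <= r)%N.
Proof.
have [le_i | lt_i] := leqP (size lam) i; first by rewrite nth_default.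
rewrite -[leqRHS](parts_sumn lam) sumnE (big_nth 0%N) big_mkord.
by rewrite (bigD1 (Ordinal lt_i)) //= leq_addr.
Qed.

Lemma part_nonincr i j : (i <= j)%N -> (nth 0 lam j <= nth 0 lam i)%N.
Proof.
move=> le_ij; have [le_j | lt_j] := leqP (size lam) j.
  by rewrite nth_default.
have geq_trans : transitive geq by move=> b a c h1 h2; apply: leq_trans h2 h1.
have lt_i := leq_ltn_trans le_ij lt_j.
exact: (sorted_leq_nth geq_trans leqnn 0 (parts_sorted lam) i j).
Qed.

Lemma card_diagram : #|diagram lam| = r.
Proof.
rewrite -[RHS](parts_sumn lam) sumnE (big_nth 0%N) big_mkord -sum1_card.
rewrite (eq_bigl (fun u : 'I_(size lam) * 'I_r =>
  xpredT u.1 && (u.2 < nth 0 lam u.1)%N)).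
  rewrite -(pair_big_dep xpredT
    (fun (i : 'I_(size lam)) (j : 'I_r) => (j < nth 0 lam i)%N)
    (fun _ _ => 1%N)) /=.
  apply: eq_bigr => i _; rewrite (big_ord_narrow (nth_part_le i)) sum1_card.
  by rewrite card_ord.
by move=> u; rewrite inE.
Qed.

Lemma tableau_exists : inhabited (tableau lam).
Proof.
pose t := [ffun x : 'I_r => enum_val (cast_ord (esym card_diagram) x)].
suff tab : is_tableau t by exact: inhabits (Sub t tab).
apply/andP; split.
  by apply/injectiveP=> x y; rewrite !ffunE => /enum_val_inj/cast_ord_inj.
rewrite eqEcard card_diagram card_imset ?cardsT ?card_ord ?leqnn ?andbT.
  by apply/fintype.subsetP=> u /imsetP[x _ ->]; rewrite ffunE enum_valP.
by move=> x y; rewrite !ffunE => /enum_val_inj/cast_ord_inj.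
Qed.

Lemma tableau_conj t1 t2 : exists s, forall x, val t2 (s x) = val t1 x.
Proof.
have /fin_all_exists[f fE] x : exists y, val t2 y = val t1 x.
  have [y fy] := tableau_onto t2 (tableau_mem t1 x).
  by exists y; rewrite fy -surjective_pairing.
have inj_f : injective f.
  by move=> x y fxy; apply: (@tableau_inj t1); rewrite -!fE fxy.
by exists (perm inj_f) => x; rewrite permE.
Qed.

Lemma column_stabiliserP t s :
  reflect (forall x, (val t (s x)).2 = (val t x).2) (s \in column_stabiliser t).
Proof. by rewrite inE; apply: (iffP forallP) => h x; apply/eqP. Qed.

Lemma column_stabiliserM t s1 s2 : s1 \in column_stabiliser t ->
  (s1 * s2 \in column_stabiliser t)%g = (s2 \in column_stabiliser t).
Proof.
move/column_stabiliserP=> C1; apply/column_stabiliserP/column_stabiliserP.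
  by move=> C2 x; have := C2 (s1^-1%g x); have := C1 (s1^-1%g x);
    rewrite permM permKV => -> ->.
by move=> C2 x; rewrite permM C2 C1.
Qed.

Lemma tabloid_ofE t x : val (tabloid_of t) x = (val t x).1.
Proof. by rewrite ffunE. Qed.

(** The elements of A outside B are at least h, the elements of B outside A
    are less than h, and there are as many of the former as of the latter. *)
Lemma sum_initial_segment n (A B : {set 'I_n}) h :
    (forall i, (i \in B) = (i < h)%N) -> #|A| = #|B| ->
  (\sum_(i in B) i + #|A :\: B| <= \sum_(i in A) i)%N.
Proof.
move=> defB cAB.
have cD : #|A :\: B| = #|B :\: A|.
  apply/eqP; rewrite -(eqn_add2l #|A :&: B|).
  by rewrite cardsID cAB finset.setIC cardsID.
rewrite (finset.big_setID A) /= [X in (_ <= X)%N](finset.big_setID B) /=.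
rewrite finset.setIC -addnA.
rewrite leq_add2l cD -sum1_card -big_split /=.
apply: (@leq_trans (h * #|A :\: B|)).
  rewrite cD mulnC -sum_nat_const; apply: leq_sum => i.
  by rewrite inE defB addn1 => /andP[].
rewrite mulnC -sum_nat_const; apply: leq_sum => i.
by rewrite inE defB -leqNgt => /andP[].
Qed.

(** The letters of a column of t lie in different rows of T, so the sum of
    these rows is at least the sum of the first rows, which is the sum in t.
    The total over all columns is the same for T and t, so each column of t
    fills an initial segment of the rows of T. *)
Lemma column_sort T t :
    (forall x y, (val t x).2 = (val t y).2 -> val T x = val T y -> x = y) ->
  exists2 s, s \in column_stabiliser t & T = tabloid_act (tabloid_of t) s.
Proof.
move=> injT.
pose col j := [set x | (val t x).2 == j].
pose A j := val T @: col j; pose B j := val (tabloid_of t) @: col j.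
have injA j : {in col j &, injective (val T)}.
  by move=> x y; rewrite !inE => /eqP xj /eqP yj; apply: injT; rewrite xj yj.
have injB j : {in col j &, injective (val (tabloid_of t))}.
  move=> x y; rewrite !inE => /eqP xj /eqP yj; rewrite !tabloid_ofE => eq1.
  apply: (@tableau_inj t); rewrite [LHS]surjective_pairing.
  by rewrite [RHS]surjective_pairing eq1 xj yj.
have cAB j : #|A j| = #|B j| by rewrite !card_in_imset.
have initB j : exists h, forall i, (i \in B j) = (i < h).
  exists (find (fun q => q <= j) lam) => i.
  transitivity (j < nth 0 lam i).
    apply/imsetP/idP => [[x] | /(tableau_onto t)[x tx]].
      by rewrite inE => /eqP<- ->; rewrite tabloid_ofE tableau_mem.
    by exists x; rewrite ?inE ?tabloid_ofE tx.
  have [lt_i | le_i] := ltnP i (find (fun q => q <= j) lam).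
    by have := before_find 0 lt_i => /= /negbT; rewrite -ltnNge.
  apply/negbTE; rewrite -leqNgt (leq_trans (part_nonincr le_i)) //.
  have [/(nth_find 0) // | ] := boolP (has (fun q => q <= j) lam).
  by move/hasNfind->; rewrite nth_default.
have le_col j : \sum_(i in B j) i + #|A j :\: B j| <= \sum_(i in A j) i.
  by have [h defB] := initB j; apply: sum_initial_segment defB (cAB j).
have sum_rows T' :
    \sum_x (val T' x : nat) = \sum_(i < size lam) nth 0 lam i * i.
  rewrite (partition_big (val T') xpredT) //=; apply: eq_bigr => i _.
  rewrite -(card_tabloid_row T') -sum_nat_const.
  by apply: eq_big => [x | x /eqP-> //]; rewrite inE.
have sum_cols T' : (forall j, {in col j &, injective (val T')}) ->
    \sum_x (val T' x : nat) = \sum_(j < r) \sum_(i in val T' @: col j) i.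
  move=> injT'; rewrite (partition_big (fun x => (val t x).2) xpredT) //=.
  apply: eq_bigr => j _; rewrite big_imset //=.
  by apply: eq_bigl => x; rewrite inE.
(* The sum of the rows of all letters depends on the shape only, so le_col
   forces equality in every column. *)
have AB j : A j \subset B j.
  have: \sum_(j < r) #|A j :\: B j| == 0.
    rewrite -leqn0 -(leq_add2l (\sum_x (val (tabloid_of t) x : nat))) addn0.
    rewrite [X in _ <= X]sum_rows -(sum_rows T).
    rewrite (sum_cols _ injB) (sum_cols _ injA).
    by rewrite -big_split; apply: leq_sum => ? _; apply: le_col.
  rewrite sum_nat_eq0 => /forallP/(_ j); rewrite cards_eq0 => /eqP AB0.
  by rewrite -finset.setD_eq0 AB0.
have BA j : B j = A j by apply/eqP; rewrite eq_sym eqEcard AB cAB leqnn.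
have /fin_all_exists[f fE] x : exists y, (val t y).2 = (val t x).2
    /\ val T y = (val t x).1.
  have: (val t x).1 \in A (val t x).2.
    by rewrite -BA -tabloid_ofE imset_f // inE.
  by case/imsetP=> y; rewrite inE => /eqP ? ->; exists y.
have inj_f : injective f.
  move=> x y fxy; have [x2 x1] := fE x; have [y2 y1] := fE y.
  apply: (@tableau_inj t); rewrite [LHS]surjective_pairing.
  by rewrite [RHS]surjective_pairing -x1 -x2 -y1 -y2 fxy.
exists (perm inj_f).
  by apply/column_stabiliserP=> x; rewrite permE; case: (fE x).
apply/val_inj/ffunP=> y; rewrite /= !ffunE.
have [_ <-] := fE ((perm inj_f)^-1%g y).
by rewrite -(permE inj_f) permKV.
Qed.

End Tableaux.

(** * Polytabloids and Young modules *)

Section Polytabloids.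

Variables (k : fieldType) (r : nat) (lam : intpart r).
Implicit Types (T : tabloid lam) (t : tableau lam) (s : {perm 'I_r}).

Local Open Scope ring_scope.

Let rM := young_perm_module lam k.

Lemma tabloid_vecJ T s :
  tabloid_vec k T *m rM s = tabloid_vec k (tabloid_act T s).
Proof.
rewrite -rowE; apply/rowP=> j; rewrite !mxE enum_rankK eqxx /=.
by congr (_%:R); rewrite -(inj_eq enum_val_inj) enum_rankK eq_sym.
Qed.

Lemma polytabloidJ t1 t2 s : (forall x, val t2 (s x) = val t1 x) ->
  polytabloid k t1 *m rM s = polytabloid k t2.
Proof.
move=> t12; rewrite /polytabloid mulmx_suml.
rewrite [RHS](reindex_inj (@conjg_inj _ s)) /=; apply: eq_big => [u | u _].
  apply/column_stabiliserP/column_stabiliserP => C x.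
    by rewrite conjgE !permM t12 C -t12 permKV.
  by have := C (s x); rewrite conjgE !permM permK !t12.
rewrite odd_permJ -scalemxAl tabloid_vecJ -tabloid_actM.
congr (_ *: tabloid_vec k _).
have -> : tabloid_of t2 = tabloid_act (tabloid_of t1) s.
  by apply/val_inj/ffunP=> y; rewrite /= !ffunE -t12 permKV.
by rewrite conjgE -tabloid_actM mulKVg.
Qed.

(** The signed column sum kappa_t of the representation theory of symmetric
    groups, as an operator. *)
Definition column_antisymmetrizer t : 'M[k]_#|{: tabloid lam}| :=
  \sum_(s in column_stabiliser t) (-1) ^+ (odd_perm s) *: rM s.

Lemma tabloid_vec_antisymmetrizer T t :
  tabloid_vec k T *m column_antisymmetrizer t =
  \sum_(s in column_stabiliser t) (-1) ^+ (odd_perm s) *: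
     tabloid_vec k (tabloid_act T s).
Proof.
rewrite mulmx_sumr; apply: eq_bigr => s _.
by rewrite -scalemxAr tabloid_vecJ.
Qed.

(** Either two letters of a column of t share a row of T, and the
    transposition of these letters pairs off the terms of the sum with
    opposite signs, or T is obtained from t by a column permutation. *)
Lemma antisymmetrizer_tabloid T t : exists c,
  tabloid_vec k T *m column_antisymmetrizer t = c *: polytabloid k t.
Proof.
rewrite tabloid_vec_antisymmetrizer.
have [/existsP[x /existsP[y /and3P[nxy /eqP cxy /eqP Txy]]] | ] := boolP
  [exists x, exists y, [&& x != y, (val t x).2 == (val t y).2
    & val T x == val T y]].
  exists 0; rewrite scale0r; pose u := tperm x y.
  have Cu : u \in column_stabiliser t.
    by apply/column_stabiliserP=> z; rewrite /u; case: tpermP => // ->.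
  have Tu : tabloid_act T u = T.
    apply/val_inj/ffunP=> z; rewrite /= ffunE tpermV.
    by case: tpermP => // ->.
  (* The odd terms are the even terms multiplied by u. Reindexing the whole sum
     by u would only show that its double vanishes. *)
  rewrite (bigID (fun s => odd_perm s)) /= (reindex_inj (mulgI u)) /=.
  rewrite [X in X + _ = _](eq_bigl (fun s =>
    (s \in column_stabiliser t) && ~~ odd_perm s)).
    rewrite -big_split /= big1 // => s _.
    rewrite odd_permM odd_tperm nxy tabloid_actM Tu addTb.
    by case: (odd_perm s);
      rewrite /= !expr0 !expr1 -scalerDl ?addrN ?addNr scale0r.
  by move=> s; rewrite column_stabiliserM // odd_permM odd_tperm nxy.
rewrite negb_exists => /forallP inj.
have [|s0 C0 ->] := @column_sort _ _ T t.
  move=> x y cxy Txy; apply/eqP; have := inj x.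
  by rewrite negb_exists => /forallP/(_ y); rewrite cxy Txy !eqxx !andbT negbK.
exists ((-1) ^+ odd_perm s0); rewrite scaler_sumr.
rewrite [RHS](reindex_inj (mulgI s0)) /=; apply: eq_big => s.
  by rewrite column_stabiliserM.
move=> _; rewrite odd_permM signr_addb scalerA mulrA -expr2 sqrr_sign mul1r.
by rewrite tabloid_actM.
Qed.

Lemma polytabloid_antisymmetrizer t :
  polytabloid k t = tabloid_vec k (tabloid_of t) *m column_antisymmetrizer t.
Proof. by rewrite tabloid_vec_antisymmetrizer. Qed.

(** Endomorphisms commute with the antisymmetrizer, whose image is the line
    spanned by the polytabloid. *)
Lemma polytabloid_eigen t h : mx_hom rM rM h ->
  exists c, polytabloid k t *m h = c *: polytabloid k t.
Proof.
move=> hh.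
have KC : column_antisymmetrizer t *m h = h *m column_antisymmetrizer t.
  rewrite mulmx_suml mulmx_sumr; apply: eq_bigr => s _.
  by rewrite -scalemxAl -scalemxAr hh ?inE.
have line (w : 'rV_#|{: tabloid lam}|) :
    exists c, w *m column_antisymmetrizer t = c *: polytabloid k t.
  have /fin_all_exists[c cE] i : exists c,
      delta_mx 0 i *m column_antisymmetrizer t = c *: polytabloid k t.
    by have [c] := antisymmetrizer_tabloid (enum_val i) t;
      rewrite /tabloid_vec enum_valK; exists c.
  exists (\sum_i w 0 i * c i).
  rewrite {1}[w]row_sum_delta mulmx_suml scaler_suml.
  by apply: eq_bigr => i _; rewrite -scalemxAl cE scalerA.
by rewrite {1}polytabloid_antisymmetrizer -mulmxA KC mulmxA; apply: line.
Qed.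

Lemma polytabloid_coef t T : polytabloid k t 0 (enum_rank T) =
  \sum_(s in column_stabiliser t)
     (-1) ^+ (odd_perm s) * (tabloid_act (tabloid_of t) s == T)%:R.
Proof.
rewrite /polytabloid summxE; apply: eq_bigr => s _.
by rewrite !mxE eqxx (inj_eq enum_rank_inj) eq_sym.
Qed.

Lemma polytabloid_coef1 t : polytabloid k t 0 (enum_rank (tabloid_of t)) = 1.
Proof.
rewrite polytabloid_coef (bigD1 1%g) /=; last first.
  by apply/column_stabiliserP=> x; rewrite perm1.
rewrite odd_perm1 tabloid_act1 eqxx mulr1 big1 ?addr0 // => s /andP[Cs ns1].
case: eqP => [ts | _]; last by rewrite mulr0.
case/eqP: ns1; apply/permP=> x; rewrite perm1; apply: (@tableau_inj _ _ t).
rewrite [LHS]surjective_pairing [RHS]surjective_pairing.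
rewrite (column_stabiliserP _ _ Cs) -!tabloid_ofE -{1}ts /= ffunE permK.
by rewrite tabloid_ofE.
Qed.

Lemma polytabloid_neq0 t : polytabloid k t != 0.
Proof.
apply/eqP=> p0; have /eqP := polytabloid_coef1 t.
by rewrite p0 mxE eq_sym oner_eq0.
Qed.

(** The eigenvalues at the polytabloid of the projections onto the summands
    add up to 1, so some summand contains the polytabloid and hence the Specht
    module. The choice of t is free because the symmetric group permutes the
    polytabloids transitively. *)
Lemma young_module_spec t : exists (m : nat)
    (Us : 'I_m -> 'M[k]_#|{: tabloid lam}|) (i : 'I_m),
  [/\ indec_decomposition rM Us, young_module lam k = Us i
    & (polytabloid k t <= young_module lam k)%MS].
Proof.
have: is_young_module (young_module lam k).
  apply: (xgetPex 0 (P := [set Y | is_young_module Y]%classic)).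
  have [m [Us decU]] := indec_decomposition_exists rM.
  have [e [he _ e1]] := indec_decomposition_proj decU.
  have [i nz] : exists i, polytabloid k t *m e i != 0.
    apply/existsP; apply: contraNT (polytabloid_neq0 t).
    rewrite negb_exists => /forallP z; rewrite -[polytabloid k t]mulmx1 -e1.
    by rewrite mulmx_sumr big1 // => i _; apply/eqP; rewrite -[_ == _]negbK.
  have [hei sei _] := he i; exists (Us i), m, Us, i, t; split=> //.
  have [indU _ _] := decU; have [modU _ _] := indU i.
  apply: cyclic_mx_sub => //; have [c ec] := polytabloid_eigen t hei.
  have nzc : c != 0 by apply: contraNneq nz => c0; rewrite ec c0 scale0r.
  rewrite -(scale1r (polytabloid k t)) -(mulVf nzc) -scalerA -ec.
  by rewrite scalemx_sub // mulmx_sub.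
case=> m [Us [i [t0 [decU defY st0]]]]; exists m, Us, i; split=> //.
have [s st] := tableau_conj t0 t; rewrite -(polytabloidJ st) defY.
have [indU _ _] := decU; have [modU _ _] := indU i.
rewrite mxmodule_trans ?inE // -defY; apply: submx_trans st0.
exact: cyclic_mx_id.
Qed.

End Polytabloids.

(** This replaces Young modules by the pairing of homomorphisms between
    permutation modules. *)
Lemma p_kostka_dual_homs (k : fieldType) (r : nat) (lam mu : intpart r)
    (t : tableau mu) :
  let rL := young_perm_module lam k in let rM := young_perm_module mu k in
  dual_homs rL rM (polytabloid k t) (p_kostka k lam mu) /\
  forall d, dual_homs rL rM (polytabloid k t) d -> d <= p_kostka k lam mu.
Proof.
move=> rL rM; have [m [Us [i [decU defY sY]]]] := young_module_spec k t.
rewrite /p_kostka defY; apply: multiplicity_dual_homs => //.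
- exact: polytabloid_neq0.
- by move=> h; apply: polytabloid_eigen.
- by rewrite -defY.
Qed.

(** * Fixed points and rotations *)

Section FixedPointSum.

Variables (p : nat) (k : fieldType) (aT : finGroupType) (X : finType).
Variable to : {action aT &-> X}.
Hypothesis pchar_k : p \in [pchar k]%R.

Local Open Scope ring_scope.

(** The fixed-point congruence modulo p for p-groups, applied to each level set
    of h. *)
Lemma sum_fixed_points (c : aT) (h : X -> k) :
    (p.-elt c)%g -> (forall x, h (to x c) = h x) ->
  \sum_x h x = \sum_(x | to x c == x) h x.
Proof.
(* A level set is labelled by one of its points, so that the labels range over
   a finite type. *)
move=> pc hc; pose lev x := [pick y | h y == h x].
have levP x y : lev x = lev y -> h x = h y.
  rewrite /lev; case: pickP => [z /eqP <- | /(_ x)]; last by rewrite eqxx.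
  by case: pickP => [u /eqP <- [->] | //].
rewrite (partition_big lev xpredT) //= [RHS](partition_big lev xpredT) //=.
apply: eq_bigr => o _; pose S := [set x | lev x == o].
have [x0 Sx0 | S0] := pickP (mem S); last first.
  rewrite !big_pred0 // => x; last by have := S0 x; rewrite !inE.
  by have := S0 x; rewrite !inE => /= ->; rewrite andbF.
have constS x : lev x == o -> h x = h x0.
  by move: Sx0; rewrite !inE => /eqP<- /eqP/levP.
have actS : [acts <[c]>, on S | to]%g.
  rewrite cycle_subG inE finset.in_setT /= inE; apply/fintype.subsetP=> x.
  by rewrite !inE /lev => Sx; rewrite hc.
have cardS := pgroup_fix_mod pc actS.
rewrite (eq_bigr (fun=> h x0)); last exact: constS.
rewrite [RHS](eq_bigr (fun=> h x0)); last by move=> x /andP[_ /constS].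
rewrite !sumr_const -mulr_natr -[in RHS]mulr_natr; congr (_ * _).
rewrite -(GRing.natr_mod_pchar pchar_k) -[RHS](GRing.natr_mod_pchar pchar_k).
rewrite (eq_card (B := S)) ?cardS => [|x]; last by rewrite !inE.
congr (_ %% _)%N%:R; apply: eq_card => x.
by rewrite afix_cycle !inE finset.sub1set inE andbC.
Qed.

End FixedPointSum.

Lemma card_ord_add r m (P : pred 'I_(r + m)) :
  #|[set x | P x]| = #|[set y | P (lshift m y)]| + #|[set z | P (rshift r z)]|.
Proof.
rewrite -!sum1_card big_mkcond big_split_ord /= -!big_mkcond /=.
by congr addn; apply: eq_bigl => x; rewrite !inE.
Qed.

Lemma perm_of_fiber_card r (C : finType) (f g : {ffun 'I_r -> C}) :
    (forall c, #|[set x | f x == c]| = #|[set x | g x == c]|) ->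
  exists s : {perm 'I_r}, forall x, g (s x) = f x.
Proof.
move=> cfg; pose tup (h : {ffun 'I_r -> C}) := [tuple h i | i < r].
have cnt h c : count_mem c (tup h) = #|[set x | h x == c]|.
  rewrite -sum1_card -sum1_count big_map big_enum_cond /=.
  by apply: eq_bigl => x; rewrite !inE.
have /tuple_permP[s sE] : perm_eq (tup f) (tup g).
  by apply/allP=> c _; rewrite /= !cnt cfg.
exists s => x; move/val_inj: sE => /(congr1 (fun t => tnth t x)).
by rewrite !tnth_mktuple.
Qed.

Section ExtendPerm.

Variables (r m : nat).

Definition ext_fun (f : 'I_r -> 'I_r) (x : 'I_(r + m)) : 'I_(r + m) :=
  match split x with inl y => lshift m (f y) | inr z => rshift r z end.

Lemma splitL (y : 'I_r) : split (lshift m y) = inl y.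
Proof. exact: (unsplitK (inl y)). Qed.

Lemma splitR (z : 'I_m) : split (rshift r z) = inr z.
Proof. exact: (unsplitK (inr z)). Qed.

Lemma ord_addP (P : 'I_(r + m) -> Prop) :
  (forall y, P (lshift m y)) -> (forall z, P (rshift r z)) -> forall x, P x.
Proof. by move=> PL PR x; rewrite -(splitK x); case: (split x). Qed.

Lemma ext_fun_inj (s : {perm 'I_r}) : injective (ext_fun s).
Proof.
apply: (can_inj (g := ext_fun s^-1%g)); apply: ord_addP => y.
  by rewrite /ext_fun !splitL permK.
by rewrite /ext_fun !splitR.
Qed.

Definition ext_perm (s : {perm 'I_r}) : {perm 'I_(r + m)} :=
  perm (@ext_fun_inj s).

Lemma ext_permL s y : ext_perm s (lshift m y) = lshift m (s y).
Proof. by rewrite permE /ext_fun splitL. Qed.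

Lemma ext_permR s z : ext_perm s (rshift r z) = rshift r z.
Proof. by rewrite permE /ext_fun splitR. Qed.

Lemma ext_perm_inj : injective ext_perm.
Proof.
move=> s1 s2 e12; apply/permP=> y; apply: (@lshift_inj _ m).
by rewrite -!ext_permL e12.
Qed.

Lemma ext_permM s1 s2 : ext_perm (s1 * s2) = (ext_perm s1 * ext_perm s2)%g.
Proof.
apply/permP; apply: ord_addP => y.
  by rewrite !permM !ext_permL permM.
by rewrite !permM !ext_permR.
Qed.

Lemma odd_ext_perm s : odd_perm (ext_perm s) = odd_perm s.
Proof.
have [ts -> _] := prod_tpermP s; elim: ts => [|[x y] ts IHts] /=.
  rewrite big_nil (_ : ext_perm 1 = 1%g) ?odd_perm1 //.
  by apply/permP; apply: ord_addP => y; rewrite ?ext_permL ?ext_permR !perm1.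
rewrite big_cons ext_permM !odd_permM {}IHts /=; congr (_ (+) _).
rewrite (_ : ext_perm _ = tperm (lshift m x) (lshift m y)).
  by rewrite !odd_tperm (inj_eq (@lshift_inj _ m)).
apply/permP; apply: ord_addP => z.
  by rewrite ext_permL inj_tperm //; apply: lshift_inj.
by rewrite ext_permR tpermD ?eq_lrshift.
Qed.

End ExtendPerm.

Section Rotation.

Variables (r a q : nat).
Hypotheses (a_gt0 : 0 < a).
Let m := a * q.

Definition rot_ord (z : 'I_m) j : 'I_m :=
  Ordinal (ltn_pmod (z + j * a) (leq_ltn_trans (leq0n z) (ltn_ord z))).

Definition rot_fun (x : 'I_(r + m)) : 'I_(r + m) :=
  match split x with
  | inl y => lshift m y
  | inr z => rshift r (rot_ord z 1)
  end.

Lemma rot_ordD z i j : rot_ord (rot_ord z i) j = rot_ord z (i + j).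
Proof. by apply: val_inj; rewrite /= modnDml -addnA mulnDl. Qed.

Lemma rot_ord_period z : rot_ord z q = z.
Proof. by apply: val_inj; rewrite /= mulnC modnDr modn_small. Qed.

Lemma rot_fun_inj : injective rot_fun.
Proof.
have q_gt0 (z : 'I_m) : 0 < q.
  by have := leq_ltn_trans (leq0n z) (ltn_ord z); rewrite muln_gt0 => /andP[].
pose g (x : 'I_(r + m)) : 'I_(r + m) :=
  match split x with
  | inl y => lshift m y
  | inr z => rshift r (rot_ord z q.-1)
  end.
apply: (can_inj (g := g)); apply: ord_addP => z; rewrite /g /rot_fun.
  by rewrite !splitL.
by rewrite !splitR rot_ordD add1n prednK ?q_gt0 ?rot_ord_period.
Qed.

(** The rotation is by a steps and not by one step, so that its cycles on the
    last a q letters have length q. *)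
Definition rotation : {perm 'I_(r + m)} := perm rot_fun_inj.

Lemma rotationL y : rotation (lshift m y) = lshift m y.
Proof. by rewrite permE /rot_fun splitL. Qed.

Lemma rotationX z j : (rotation ^+ j)%g (rshift r z) = rshift r (rot_ord z j).
Proof.
elim: j => [|j IHj].
  rewrite perm1; congr rshift; apply: val_inj.
  by rewrite /= mul0n addn0 modn_small.
by rewrite expgSr permM IHj permE /rot_fun splitR rot_ordD addn1.
Qed.

Lemma rotation_order : (rotation ^+ q)%g = 1%g.
Proof.
apply/permP; apply: ord_addP => z; rewrite perm1.
  by elim: q => [|j IHj]; rewrite ?perm1 // expgSr permM IHj rotationL.
by rewrite rotationX rot_ord_period.
Qed.

Lemma rot_ord_inj z : {in [pred j | j < q] &, injective (rot_ord z)}.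
Proof.
move=> i j; rewrite !inE => lti ltj /(congr1 val) /= /eqP.
rewrite eqn_modDl mulnC (mulnC j) /m -!muln_modr eqn_pmul2l // !modn_small //.
by move/eqP.
Qed.

End Rotation.

(** * Lengthening the first row *)

Lemma card_const_ord m (b : bool) : #|[pred _ : 'I_m | b]| = b * m.
Proof.
case: b; first by rewrite mul1n -[RHS]card_ord; apply: eq_card.
by rewrite mul0n; apply: eq_card0.
Qed.

Section ExtendTabloid.

Variables (r m : nat) (lam : intpart r).
Implicit Types (T : tabloid lam) (t : tableau lam) (s : {perm 'I_r}).

Definition ext_part : intpart (r + m) := add_intpart lam (one_part m).

Lemma nth_ext_part i : nth 0 ext_part i = nth 0 lam i + (i == 0) * m.
Proof.
by rewrite nth_add_parts /=; case: i => [|i] /=; rewrite ?mul1n ?nth_nil.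
Qed.

Lemma size_ext_part : size ext_part = maxn (size lam) 1.
Proof. by rewrite size_mkseq. Qed.

Lemma size_ext_part_ge : size lam <= size ext_part.
Proof. by rewrite size_ext_part leq_maxl. Qed.

Lemma size_ext_part_gt0 : 0 < size ext_part.
Proof. by rewrite size_ext_part leq_maxr. Qed.

Definition ext_row (i : 'I_(size lam)) : 'I_(size ext_part) :=
  widen_ord size_ext_part_ge i.

Definition first_row : 'I_(size ext_part) := Ordinal size_ext_part_gt0.

Lemma ext_row_inj : injective ext_row.
Proof. by move=> i j /(congr1 val) /= /val_inj. Qed.

Definition ext_tabloid_fun T : {ffun 'I_(r + m) -> 'I_(size ext_part)} :=
  [ffun x => match split x with
   | inl y => ext_row (val T y)
   | inr _ => first_row end].

Lemma ext_tabloid_subproof T : is_tabloid (ext_tabloid_fun T).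
Proof.
apply/forallP=> i; apply/eqP; rewrite card_ord_add nth_ext_part; congr addn.
  have [lt_i | le_i] := ltnP i (size lam).
    rewrite -(card_tabloid_row T (Ordinal lt_i)); apply: eq_card => y.
    by rewrite !inE ffunE splitL -val_eqE.
  rewrite nth_default //; apply: eq_card0 => y.
  rewrite !inE ffunE splitL -val_eqE /=.
  by apply: contraTF le_i => /eqP<-; rewrite -ltnNge ltn_ord.
rewrite (eq_card (B := [pred z : 'I_m | i == 0 :> nat])) ?card_const_ord //.
by move=> z; rewrite !inE ffunE splitR -val_eqE /= eq_sym.
Qed.

Definition ext_tabloid T : tabloid ext_part := Sub _ (ext_tabloid_subproof T).

Lemma ext_tabloidL T y : val (ext_tabloid T) (lshift m y) = ext_row (val T y).
Proof. by rewrite /= ffunE splitL. Qed.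

Lemma ext_tabloidR T z : val (ext_tabloid T) (rshift r z) = first_row.
Proof. by rewrite /= ffunE splitR. Qed.

Lemma ext_tabloid_inj : injective ext_tabloid.
Proof.
move=> T U TU; apply/val_inj/ffunP=> y; apply: ext_row_inj.
by rewrite -!ext_tabloidL TU.
Qed.

Lemma ext_tabloid_act T s :
  ext_tabloid (tabloid_act T s) = tabloid_act (ext_tabloid T) (ext_perm m s).
Proof.
apply/esym/tabloid_act_eqP; apply: ord_addP => y.
  by rewrite ext_permL !ext_tabloidL /= ffunE permK.
by rewrite ext_permR !ext_tabloidR.
Qed.

Lemma ext_tabloidP (T' : tabloid ext_part) : 0 < r ->
  (forall z, val T' (rshift r z) = first_row) -> exists T, T' = ext_tabloid T.
Proof.
move=> r_gt0 TR; have size_lam : size ext_part = size lam.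
  rewrite size_ext_part; apply/maxn_idPl; rewrite lt0n size_eq0.
  by apply: contraTneq r_gt0 => lam0; rewrite -(parts_sumn lam) lam0.
pose T := [ffun y => cast_ord size_lam (val T' (lshift m y))].
suff tabT : is_tabloid T.
  exists (Sub T tabT); apply/val_inj/ffunP; apply: ord_addP => y.
    by rewrite ext_tabloidL /= ffunE; apply: val_inj.
  by rewrite ext_tabloidR TR.
apply/forallP=> i; apply/eqP.
have := card_tabloid_row T' (ext_row i); rewrite card_ord_add nth_ext_part.
rewrite [X in _ + X = _](_ : _ = (val i == 0) * m).
  move/addIn=> <-; apply: eq_card => y; by rewrite !inE ffunE -!val_eqE.
rewrite (eq_card (B := [pred z : 'I_m | i == 0 :> nat])) ?card_const_ord //.
by move=> z; rewrite !inE TR -val_eqE /= eq_sym.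
Qed.

Lemma ext_col_subproof (z : 'I_m) : nth 0 lam 0 + z < r + m.
Proof. by rewrite -addnS leq_add ?nth_part_le. Qed.

(** The added letters go to the end of the first row, beyond all columns of t,
    so that the column stabiliser does not grow. *)
Definition ext_tableau_fun t :
    {ffun 'I_(r + m) -> 'I_(size ext_part) * 'I_(r + m)} :=
  [ffun x => match split x with
   | inl y => (ext_row (val t y).1, lshift m (val t y).2)
   | inr z => (first_row, Ordinal (ext_col_subproof z)) end].

Lemma tableau_col_lt t y : (val t y).2 < nth 0 lam 0.
Proof. exact: leq_trans (tableau_mem t y) (part_nonincr lam (leq0n _)). Qed.

Lemma ext_tableau_subproof t : is_tableau (ext_tableau_fun t).
Proof.
have inj : injective (ext_tableau_fun t).
  apply: ord_addP => y; apply: ord_addP => z; rewrite !ffunE ?splitL ?splitR.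
  - case=> /val_inj t1 /val_inj t2; congr lshift; apply: (@tableau_inj _ _ t).
    by rewrite [LHS]surjective_pairing t1 t2 -surjective_pairing.
  - by case=> _ t2; have := tableau_col_lt t y; rewrite t2 ltnNge leq_addr.
  - by case=> _ t2; have := tableau_col_lt t z; rewrite -t2 ltnNge leq_addr.
  - by case=> /addnI/val_inj->.
apply/andP; split; first exact/injectiveP.
rewrite eqEcard card_diagram card_imset // cardsT card_ord leqnn andbT.
apply/fintype.subsetP=> u /imsetP[x _ ->]; rewrite inE ffunE.
move: x; apply: ord_addP => y; rewrite ?splitL ?splitR /= nth_ext_part.
  exact: ltn_addr (tableau_mem t y).
by rewrite mul1n ltn_add2l.
Qed.

Definition ext_tableau t : tableau ext_part := Sub _ (ext_tableau_subproof t).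

Lemma ext_tableauL t y : val (ext_tableau t) (lshift m y) =
  (ext_row (val t y).1, lshift m (val t y).2).
Proof. by rewrite /= ffunE splitL. Qed.

Lemma ext_tableauR t z : val (ext_tableau t) (rshift r z) =
  (first_row, Ordinal (ext_col_subproof z)).
Proof. by rewrite /= ffunE splitR. Qed.

Lemma tabloid_of_ext t : tabloid_of (ext_tableau t) = ext_tabloid (tabloid_of t).
Proof.
apply/val_inj/ffunP; apply: ord_addP => y; rewrite tabloid_ofE.
  by rewrite ext_tableauL ext_tabloidL tabloid_ofE.
by rewrite ext_tableauR ext_tabloidR.
Qed.

(** The added letters are alone in their columns. *)
Lemma column_stabiliser_ext t :
  column_stabiliser (ext_tableau t) = ext_perm m @: column_stabiliser t.
Proof.
apply/setP=> s'; apply/idP/imsetP => [/column_stabiliserP C' | [s Cs ->]];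
  last first.
  apply/column_stabiliserP; apply: ord_addP => y; last by rewrite ext_permR.
  by rewrite ext_permL !ext_tableauL /= (column_stabiliserP _ _ Cs).
have s'R z : s' (rshift r z) = rshift r z.
  have := C' (rshift r z); rewrite -(splitK (s' _)); case: (split _) => y /=.
    rewrite ext_tableauL ext_tableauR /= => /(congr1 val) /= ty.
    by have := tableau_col_lt t y; rewrite ty ltnNge leq_addr.
  by rewrite !ext_tableauR /= => /(congr1 val) /= /addnI/val_inj->.
have /fin_all_exists[f fE] y : exists y', s' (lshift m y) = lshift m y'.
  rewrite -(splitK (s' _)); case def_s: (split _) => [y' | z] /=.
    by exists y'.
  have: s' (lshift m y) = s' (rshift r z).
    by rewrite s'R -(splitK (s' (lshift m y))) def_s.
  by move/perm_inj/eqP; rewrite eq_lrshift.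
have inj_f : injective f.
  move=> x y fxy; apply: (@lshift_inj _ m); apply: (@perm_inj _ s').
  by rewrite !fE fxy.
exists (perm inj_f).
  apply/column_stabiliserP=> y; rewrite permE.
  have := C' (lshift m y); rewrite fE !ext_tableauL /= => /(congr1 val) /=.
  exact: val_inj.
apply/permP; apply: ord_addP => y; first by rewrite ext_permL permE fE.
by rewrite ext_permR s'R.
Qed.

End ExtendTabloid.

(** * The Brauer homomorphism and stability *)

Section HomsAsKernels.

Variables (k : fieldType) (r : nat) (mu lam : intpart r).

Local Open Scope ring_scope.

Lemma young_homP (f : 'M[k]_(#|{: tabloid mu}|, #|{: tabloid lam}|)) :
  mx_hom (young_perm_module mu k) (young_perm_module lam k) f <->
  forall (T : tabloid mu) (U : tabloid lam) s,
    f (enum_rank (tabloid_act T s)) (enum_rank (tabloid_act U s)) =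
    f (enum_rank T) (enum_rank U).
Proof.
have entL s T U : (young_perm_module mu k s *m f) (enum_rank T) (enum_rank U) =
    f (enum_rank (tabloid_act T s)) (enum_rank U).
  rewrite mxE (bigD1 (enum_rank (tabloid_act T s))) //=.
  rewrite !mxE !enum_rankK eqxx mul1r.
  rewrite big1 ?addr0 // => i ni; rewrite !mxE enum_rankK.
  by rewrite -(inj_eq enum_rank_inj) enum_valK eq_sym (negPf ni) mul0r.
have entR s T U : (f *m young_perm_module lam k s) (enum_rank T)
    (enum_rank (tabloid_act U s)) = f (enum_rank T) (enum_rank U).
  rewrite mxE (bigD1 (enum_rank U)) //= !mxE !enum_rankK eqxx mulr1.
  rewrite big1 ?addr0 // => i ni; rewrite !mxE enum_rankK.
  rewrite (inj_eq (@tabloid_act_inj _ _ s)) -(inj_eq enum_rank_inj) enum_valK.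
  by rewrite (negPf ni) mulr0.
split=> [hf T U s | hf s _].
  by rewrite -entL hf ?inE // entR.
apply/matrixP=> i j; rewrite -(enum_valK i) -(enum_valK j).
have -> : enum_val j = tabloid_act (tabloid_act (enum_val j) s^-1%g) s.
  by rewrite -tabloid_actM mulVg tabloid_act1.
by rewrite entL entR hf.
Qed.

(** The eigenvalue of f g at the polytabloid of t, read off at the tabloid of t
    and written as a double sum over column permutations and tabloids. In this
    form the pairings for r and for r + m are compared term by term. *)
Definition polytabloid_pairing (t : tableau mu)
    (f : 'M[k]_(#|{: tabloid mu}|, #|{: tabloid lam}|))
    (g : 'M[k]_(#|{: tabloid lam}|, #|{: tabloid mu}|)) : k :=
  \sum_(s in column_stabiliser t) (-1) ^+ (odd_perm s) *
    \sum_(U : tabloid lam)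
      f (enum_rank (tabloid_act (tabloid_of t) s)) (enum_rank U) *
      g (enum_rank U) (enum_rank (tabloid_of t)).

Lemma polytabloid_pairingE t f g :
  (polytabloid k t *m f *m g) 0 (enum_rank (tabloid_of t)) =
  polytabloid_pairing t f g.
Proof.
rewrite -mulmxA mulmx_suml summxE; apply: eq_bigr => s _.
rewrite -scalemxAl -rowE mxE; congr (_ * _); rewrite !mxE.
rewrite (reindex (fun U : tabloid lam => enum_rank U)) //=.
by apply: onW_bij; apply: enum_rank_bij.
Qed.

Lemma dual_homs_pairing t d :
  dual_homs (young_perm_module lam k) (young_perm_module mu k)
    (polytabloid k t) d <->
  exists (f : 'I_d -> 'M[k]_(#|{: tabloid mu}|, #|{: tabloid lam}|))
         (g : 'I_d -> 'M[k]_(#|{: tabloid lam}|, #|{: tabloid mu}|)),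
    [/\ forall i, mx_hom (young_perm_module mu k) (young_perm_module lam k) (f i),
        forall i, mx_hom (young_perm_module lam k) (young_perm_module mu k) (g i)
      & forall i j, polytabloid_pairing t (f i) (g j) = (i == j)%:R].
Proof.
split=> [] [f [g [hf hg fg]]]; exists f, g; split=> // i j.
  by rewrite -polytabloid_pairingE fg mxE polytabloid_coef1 mulr1.
rewrite -mulmxA; have [c ec] := polytabloid_eigen t (mx_homM (hf i) (hg j)).
rewrite ec -(fg i j) -polytabloid_pairingE -mulmxA ec mxE.
by rewrite polytabloid_coef1 mulr1.
Qed.

End HomsAsKernels.

Section OrbitTransfer.

Variables (r m : nat) (mu lam : intpart r).

(** The relative position of two tabloids is the matrix of the numbers of
    letters with given rows. Extending adds m to its first entry, so two pairs
    in the same position after the extension were so before. *)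
Lemma ext_orbit (T1 T2 : tabloid mu) (U1 U2 : tabloid lam) s' :
    tabloid_act (ext_tabloid m T1) s' = ext_tabloid m T2 ->
    tabloid_act (ext_tabloid m U1) s' = ext_tabloid m U2 ->
  exists s, tabloid_act T1 s = T2 /\ tabloid_act U1 s = U2.
Proof.
move=> /tabloid_act_eqP TT /tabloid_act_eqP UU.
pose pos (T : tabloid mu) (U : tabloid lam) := [ffun x => (val T x, val U x)].
have [[i j]|s sE] := @perm_of_fiber_card _ _ (pos T1 U1) (pos T2 U2);
  last first.
  exists s; split; apply/tabloid_act_eqP=> x; have := sE x; rewrite !ffunE.
    by case.
  by case.
pose P T U := [pred x | (val (ext_tabloid m T) x == ext_row m i)
  && (val (ext_tabloid m U) x == ext_row m j)].
have cardP T U : #|[set x | P T U x]| = #|[set x | pos T U x == (i, j)]|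
    + #|[set z : 'I_m | (first_row m mu == ext_row m i)
        && (first_row m lam == ext_row m j)]|.
  rewrite card_ord_add; congr addn; apply: eq_card => x; rewrite !inE /=.
    by rewrite !ext_tabloidL !(inj_eq (@ext_row_inj _ _ _)) ffunE xpair_eqE.
  by rewrite !ext_tabloidR.
apply/eqP; rewrite -(eqn_add2r #|[set z : 'I_m | (first_row m mu == ext_row m i)
  && (first_row m lam == ext_row m j)]|) -!cardP; apply/eqP.
rewrite -[RHS](card_preimset _ (@perm_inj _ s')); apply: eq_card => x.
by rewrite !inE TT UU.
Qed.

Variable k : fieldType.

Local Open Scope ring_scope.

(** The Brauer homomorphism for a p-group whose fixed tabloids are the extended
    ones: homomorphisms are matrices indexed by tabloids, and it keeps the
    entries at fixed points. *)
Definition restrict_hom (f' : 'M[k]_(#|{: tabloid (ext_part m mu)}|,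
    #|{: tabloid (ext_part m lam)}|)) :
    'M[k]_(#|{: tabloid mu}|, #|{: tabloid lam}|) :=
  \matrix_(i, j) f' (enum_rank (ext_tabloid m (enum_val i)))
                    (enum_rank (ext_tabloid m (enum_val j))).

Lemma restrict_homE f' T U : restrict_hom f' (enum_rank T) (enum_rank U) =
  f' (enum_rank (ext_tabloid m T)) (enum_rank (ext_tabloid m U)).
Proof. by rewrite mxE !enum_rankK. Qed.

Lemma restrict_hom_hom f' :
  mx_hom (young_perm_module (ext_part m mu) k)
         (young_perm_module (ext_part m lam) k) f' ->
  mx_hom (young_perm_module mu k) (young_perm_module lam k) (restrict_hom f').
Proof.
move=> /young_homP hf'; apply/young_homP=> T U s.
by rewrite !restrict_homE !ext_tabloid_act hf'.
Qed.

(** Homomorphisms are the functions on pairs of tabloids that are constant on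
    relative positions. Such a function is extended by zero to the positions
    that are not met by extended tabloids. *)
Lemma restrict_hom_onto f :
    mx_hom (young_perm_module mu k) (young_perm_module lam k) f ->
  exists2 f', mx_hom (young_perm_module (ext_part m mu) k)
                     (young_perm_module (ext_part m lam) k) f'
            & restrict_hom f' = f.
Proof.
move=> /young_homP hf.
pose orb T' U' (TU : tabloid mu * tabloid lam) := [exists s,
  (tabloid_act (ext_tabloid m TU.1) s == T') &&
  (tabloid_act (ext_tabloid m TU.2) s == U')].
pose F T' U' := if [pick TU | orb T' U' TU] is Some TU
  then f (enum_rank TU.1) (enum_rank TU.2) else 0.
exists (\matrix_(i, j) F (enum_val i) (enum_val j)).
  apply/young_homP=> T' U' s; rewrite !mxE !enum_rankK /F.
  rewrite (eq_pick (Q := orb T' U')) // => TU.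
  apply/existsP/existsP => [] [s1 /andP[/eqP sT /eqP sU]].
    exists (s1 * s^-1)%g; rewrite !tabloid_actM sT sU -!tabloid_actM.
    by rewrite mulgV !tabloid_act1 !eqxx.
  by exists (s1 * s)%g; rewrite !tabloid_actM sT sU !eqxx.
apply/matrixP=> i j; rewrite !mxE !enum_rankK /F.
case: pickP => [[T U] | no_TU].
  case/existsP=> s' /andP[/eqP sT /eqP sU] /=.
  have [s [defT defU]] := ext_orbit sT sU.
  by rewrite -(hf T U s) defT defU !enum_valK.
have /existsP[] := no_TU (enum_val i, enum_val j).
by exists 1%g; rewrite !tabloid_act1 !eqxx.
Qed.

End OrbitTransfer.

Section Stability.

Variables (p : nat) (k : fieldType) (r n a : nat) (mu lam : intpart r).
Hypotheses (pchar_k : p \in [pchar k]%R) (r_gt0 : 0 < r) (a_gt0 : 0 < a).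
Hypothesis lam1_lt : nth 0 lam 1 < p ^ n.

Let m := a * p ^ n.
Let c : {perm 'I_(r + m)} := rotation r a (p ^ n).

Lemma ext_tabloid_rotation (nu : intpart r) (T : tabloid nu) :
  tabloid_act (ext_tabloid m T) c = ext_tabloid m T.
Proof.
apply/tabloid_act_eqP; apply: ord_addP => y; first by rewrite rotationL.
by rewrite -(expg1 c) rotationX !ext_tabloidR.
Qed.

(** A fixed tabloid has each cycle of the rotation in a single row, and a row
    other than the first is too short to hold a cycle of length p ^ n. *)
Lemma rotation_fixed (T' : tabloid (ext_part m lam)) :
  tabloid_act T' c = T' -> exists T, T' = ext_tabloid m T.
Proof.
move=> /tabloid_act_eqP fixT'; apply: ext_tabloidP => // z.
have constT' j : val T' (rshift r (rot_ord z j)) = val T' (rshift r z).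
  rewrite -rotationX; elim: j => [|j IHj]; first by rewrite perm1.
  by rewrite expgSr permM fixT'.
apply/eqP; rewrite -val_eqE /=; apply: contraLR lam1_lt => nz.
set i := val T' _ in constT' nz.
rewrite -leqNgt -{1}[p ^ n]card_ord.
have inj_rot : injective (fun j : 'I_(p ^ n) => rshift r (rot_ord z j)).
  move=> j1 j2 /rshift_inj/(rot_ord_inj a_gt0) j12.
  by apply: val_inj; apply: j12; rewrite inE.
rewrite -(card_imset _ inj_rot).
apply: (@leq_trans #|[set x | val T' x == i]|).
  apply: subset_leq_card; apply/fintype.subsetP=> _ /imsetP[j _ ->].
  by rewrite inE constT'.
rewrite card_tabloid_row nth_ext_part (negPf nz) mul0n addn0.
by apply: part_nonincr; rewrite lt0n.
Qed.

Local Open Scope ring_scope.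

(** The column stabilisers of t and of its extension agree, and in the inner
    sum the tabloids that are not fixed by the rotation contribute zero. *)
Lemma pairing_restrict (t : tableau mu) f' g' :
    mx_hom (young_perm_module (ext_part m mu) k)
           (young_perm_module (ext_part m lam) k) f' ->
    mx_hom (young_perm_module (ext_part m lam) k)
           (young_perm_module (ext_part m mu) k) g' ->
  polytabloid_pairing (ext_tableau m t) f' g' =
  polytabloid_pairing t (restrict_hom f') (restrict_hom g').
Proof.
move=> /young_homP hf /young_homP hg.
rewrite /polytabloid_pairing column_stabiliser_ext big_imset /=; last first.
  by move=> s1 s2 _ _; apply: ext_perm_inj.
apply: eq_bigr => s _; rewrite odd_ext_perm tabloid_of_ext -ext_tabloid_act.
congr (_ * _); set T := tabloid_act _ s; set T0 := tabloid_of t.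
pose act := TotalAction (@tabloid_act1 _ (ext_part m lam))
                        (@tabloid_actM _ (ext_part m lam)).
have pc : (p.-elt c)%g.
  rewrite /p_elt (@pnat_dvd _ (p ^ n)%N) ?pnatX ?pnat_id ?(pcharf_prime pchar_k) //.
  by rewrite order_dvdn rotation_order.
rewrite (@sum_fixed_points p k _ _ act pchar_k c) //=; last first.
  move=> U; rewrite -{1}(ext_tabloid_rotation T) -{1}(ext_tabloid_rotation T0).
  by rewrite hf hg.
rewrite (eq_bigl [in [set ext_tabloid m U | U in [set: tabloid lam]]]) => [|U'].
  rewrite big_imset /=; last by move=> U1 U2 _ _; apply: ext_tabloid_inj.
  by apply: eq_big => [U | U _]; rewrite ?inE // !restrict_homE.
apply/eqP/imsetP => [/rotation_fixed[U ->] | [U _ ->]]; first by exists U.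
exact: ext_tabloid_rotation.
Qed.

Lemma dual_homs_ext (t : tableau mu) d :
  dual_homs (young_perm_module (ext_part m lam) k)
    (young_perm_module (ext_part m mu) k) (polytabloid k (ext_tableau m t)) d <->
  dual_homs (young_perm_module lam k) (young_perm_module mu k)
    (polytabloid k t) d.
Proof.
split=> /dual_homs_pairing[f [g [hf hg fg]]]; apply/dual_homs_pairing.
  exists (fun i => restrict_hom (f i)), (fun i => restrict_hom (g i)).
  split=> [i | i | i j]; try exact: restrict_hom_hom.
  by rewrite -pairing_restrict.
have /fin_all_exists2[f' hf' fE] i := restrict_hom_onto m (hf i).
have /fin_all_exists2[g' hg' gE] i := restrict_hom_onto m (hg i).
by exists f', g'; split=> // i j; rewrite pairing_restrict // fE gE.
Qed.

End Stability.

Theorem theorem14 (p : nat) (hp : prime p) (k : fieldType)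
    (hk : p \in [pchar k]%R) (r n : nat) (hr : (0 < r)%N) (lam : intpart r)
    (hlam : (nth 0 lam 1 < p ^ n)%N) (a : nat) (ha : (0 < a)%N)
    (mu : intpart r) :
  p_kostka k (add_intpart lam (one_part (a * p ^ n)%N))
             (add_intpart mu (one_part (a * p ^ n)%N))
  = p_kostka k lam mu.
Proof.
have [t] := tableau_exists mu.
have [dual_c max_c] := p_kostka_dual_homs k lam t.
have [dual_c' max_c'] := p_kostka_dual_homs k (ext_part (a * p ^ n) lam)
  (ext_tableau (a * p ^ n) t).
have ext d := dual_homs_ext hk hr ha hlam t d.
apply/eqP; rewrite eqn_leq; apply/andP; split.
  by apply: max_c; apply/ext.
by apply: max_c'; apply/ext.
Qed.
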